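(* Let $\sigma\in\{1,-1\}$, and let $w_1,\dots,w_n$, $\widehat w_1,\dots,\widehat w_n$, $\Omega$, $V$ and the Hamiltonian $$H(\mathbf z,\mathbf Z)=\frac{(1+\sigma|\mathbf z|^2)^2}{4}|\mathbf Z|^2+2\Omega\,\mathrm{Im}(\mathbf z\overline{\mathbf Z})-2V(\mathbf z,\overline{\mathbf z})$$ of the restricted curved $(n+1)$-body problem be as in the context. Then, for each $k=1,\dots,n$, the transformation $$\mathbf z=g(w)=w\overline w+w_k,$$ with the time transformation $\dfrac{dt}{ds}=|w|^2$, regularizes the singularity of $H$ due to collision between the negligible mass and the $k$-th primary body.
   Context: Restricted curved $(n+1)$-body problem. $\sigma=1$ corresponds to the unit sphere $\mathbb S^2\subset\mathbb R^3$, and $\sigma=-1$ to the hyperbolic plane $\mathbb H^2=\{x^2+y^2-z^2=-1,\ z>0\}$. A regular $n$-gon ($n\ge 2$) of primaries with equal (unit) masses lies at constant height $z\neq 0$ on a circle of radius $r>0$ (so $r^2+\sigma z^2=\sigma$) and rotates rigidly about the $z$-axis with angular velocity $\Omega$, as a relative equilibrium, where $$\Omega^2=\sum_{j=1}^{n-1}\frac{1-\cos(2\pi j/n)}{[\sigma-\sigma(r^2\cos(2\pi j/n)+\sigma-r^2)^2]^{3/2}}.$$ A further body of negligible mass moves under the attraction of the primaries without affecting them. In the rotating frame the primaries are fixed at $(k_j,h_j,z)$ with $k_j=r\cos(2\pi(j-1)/n)$, $h_j=r\sin(2\pi(j-1)/n)$. After stereographic projection from $(0,0,-1)$ to $\mathbb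 C$, the primaries are at $w_j=\frac{k_j+ih_j}{1+z}$; put $\widehat w_j=-\frac{k_j+ih_j}{1-z}$. The position of the negligible mass is $\mathbf z=u+iv$ (in the open unit disk if $\sigma=-1$), its momentum is $\mathbf Z=p_u+ip_v$, and $$V(\mathbf z,\overline{\mathbf z})=\sum_{j=1}^n\frac{k_j(\mathbf z+\overline{\mathbf z})-ih_j(\mathbf z-\overline{\mathbf z})+\sigma z(1-\sigma|\mathbf z|^2)}{r\,|\mathbf z-w_j|\,|\mathbf z-\widehat w_j|},$$ where the non-bold $z$ is the constant height of the primaries. The collision with the $k$-th primary is the singularity $\mathbf z=w_k$ of $H$. Meaning of ''regularize'': the momentum is changed by $\mathbf Z=W/\overline{g'(w)}$, where $g'(w)$ is taken to be $\overline w$, so that $dt/ds=|g'(w)|^2=|w|^2$. On a fixed energy level $H=-C/2$ one passes to the Hamiltonian $\hat H=|g'(w)|^2\left(H+\frac C2\right)$, expressed in $(w,W)$ with time $s$ and considered at the level $\hat H=0$. To regularize the collision singularity means that it is no longer present in $\hat H$. *)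

(* Defs.v *)
From Stdlib Require Import Reals.
From Coquelicot Require Import Coquelicot.

Open Scope R_scope.

(** * Smooth functions of (position, momentum) *)

(* [C * C] as a 4-dimensional real normed space: smoothness is in the real
   sense, in the coordinates (u, v, p_u, p_v). *)
Definition phase_space : NormedModule R_AbsRing :=
  prod_NormedModule R_AbsRing C_R_NormedModule C_R_NormedModule.

(* F is of class C^m on U (meant for open U): iterated Frechet
   differentiability with continuous m-th order derivatives.  [DF x e] is the
   derivative at x in the direction e. *)
Fixpoint class_C (m : nat) (U : phase_space -> Prop) (F : phase_space -> R)
  : Prop :=
  match m with
  | O => forall x, U x -> continuous F x
  | S m' => exists DF : phase_space -> phase_space -> R,
      (forall x, U x -> filterdiff F (locally x) (DF x)) /\
      (forall e, class_C m' U (fun x => DF x e))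
  end.

Definition smooth_on (U : phase_space -> Prop) (F : phase_space -> R) : Prop :=
  forall m, class_C m U F.

(* F, meaningful at positions in D only, has a smooth extension to the
   positions in E, all momenta being allowed.  This formulation makes the values
   of F outside D (where a total division may return anything) irrelevant. *)
Definition extends_smoothly (D E : C -> Prop) (F : C -> C -> R) : Prop :=
  exists Fext : phase_space -> R,
    smooth_on (fun x => E (fst x)) Fext /\
    (forall q Z : C, D q -> Fext (q, Z) = F q Z).

(** * Regularizing transformations *)

(* hat H = |g'(w)|^2 (H + Cst/2) in the variables (w, W), where z = g(w) and
   Z = W / conj(g'(w)).  The function dg playing the role of g' is a separate
   argument: it is prescribed together with g, and g need not be holomorphic. *)
Definition transformed_hamiltonian (H : C -> C -> R) (g dg : C -> C)
    (Cst : R) (w W : C) : R :=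
  (Cmod (dg w)) ^ 2 * (H (g w) (W / Cconj (dg w))%C + Cst / 2).

(* H is a Hamiltonian with configuration space Q, and a is a point outside Q.
   The transformation z = g(w), Z = W / conj(dg(w)), dt/ds = tau(w) regularizes
   the singularity z = a of H when
   - it is a singularity: H has no smooth extension to z = a;
   - the time change is the one used in hat H;
   - z = a is covered by g, and only by limits of points at which hat H is
     defined (so that the extension below is determined by hat H);
   - whatever the energy level H = - Cst/2, hat H has no singularity at the
     points w with g(w) = a. *)
Definition regularizes (Q : C -> Prop) (H : C -> C -> R) (a : C)
    (g dg : C -> C) (tau : C -> R) : Prop :=
  ~ extends_smoothly Q (fun q => Q q \/ q = a) H /\
  (forall w, tau w = (Cmod (dg w)) ^ 2) /\
  (exists w0, g w0 = a) /\
  (forall w0, g w0 = a -> forall eps : R, 0 < eps ->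
     exists w, Cmod (w - w0)%C < eps /\ Q (g w) /\ dg w <> 0%C) /\
  (forall Cst : R,
     extends_smoothly (fun w => Q (g w) /\ dg w <> 0%C)
                      (fun w => Q (g w) \/ g w = a)
                      (transformed_hamiltonian H g dg Cst)).

(** * The restricted curved (n+1)-body problem *)

(* The primaries are numbered j = 1, ..., n. *)
Definition kcoord (n : nat) (r : R) (j : nat) : R :=
  r * cos (2 * PI * (INR j - 1) / INR n).

Definition hcoord (n : nat) (r : R) (j : nat) : R :=
  r * sin (2 * PI * (INR j - 1) / INR n).

Definition primary (n : nat) (r z : R) (j : nat) : C :=
  ((RtoC (kcoord n r j) + Ci * RtoC (hcoord n r j)) / RtoC (1 + z))%C.

Definition antiprimary (n : nat) (r z : R) (j : nat) : C :=
  (- ((RtoC (kcoord n r j) + Ci * RtoC (hcoord n r j)) / RtoC (1 - z)))%C.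

(* The right-hand side of the relative equilibrium condition for Omega^2; the
   bracket is positive, so [Rpower] is the genuine real power. *)
Definition Omega_sqr (sigma : R) (n : nat) (r : R) : R :=
  sum_n_m (fun j : nat =>
    let c := cos (2 * PI * INR j / INR n) in
    (1 - c) /
    Rpower (sigma - sigma * (r ^ 2 * c + sigma - r ^ 2) ^ 2) (3 / 2))
  1 (n - 1).

(* [Re] only changes the type: the complex expression under it is real. *)
Definition potential (sigma : R) (n : nat) (r z : R) (q : C) : R :=
  sum_n_m (fun j : nat =>
    (Re (RtoC (kcoord n r j) * (q + Cconj q)
         - Ci * RtoC (hcoord n r j) * (q - Cconj q))%C
     + sigma * z * (1 - sigma * (Cmod q) ^ 2)) /
    (r * Cmod (q - primary n r z j)%C * Cmod (q - antiprimary n r z j)%C))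
  1 n.

Definition hamiltonian (sigma : R) (n : nat) (r z Omega : R) (q Z : C) : R :=
  (1 + sigma * (Cmod q) ^ 2) ^ 2 / 4 * (Cmod Z) ^ 2
  + 2 * Omega * Im (q * Cconj Z)%C
  - 2 * potential sigma n r z q.

(* The open unit disk (sigma = -1) or the plane (sigma = 1), without the
   singularities of the potential. *)
Definition configuration_space (sigma : R) (n : nat) (r z : R) (q : C) : Prop :=
  (sigma = -1 -> Cmod q < 1) /\
  (forall j : nat, (1 <= j <= n)%nat ->
     q <> primary n r z j /\ q <> antiprimary n r z j).

(* Main.v *)
Require Import Defs.
From Stdlib Require Import Reals Lra Lia FunctionalExtensionality.
From Coquelicot Require Import Coquelicot.

Open Scope R_scope.

(** Since [g w - w_k = |w|^2], the factor [|w|^2] of [hat H] cancels the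
    denominator [|g w - w_k|] of the k-th summand of [V]; it also turns
    [|W / w|^2] into [|W|^2] and [Im (g w * conj (W / w))] into
    [Im (g w * conj W * w)].  What remains is built from polynomials, square
    roots of positive functions and inverses of nonzero ones, because the [w_j]
    are pairwise distinct and [|w_j| <> |hat w_i|] when [z <> 0].

    At [w = 0], [W = 0] the value of [hat H] comes only from the k-th summand,
    whose numerator at [w_k] is [2 sigma / (1 + z) <> 0].  If [H] had a smooth
    extension to [w_k], then [hat H = |w|^2 H] (with [C = 0]) would tend to [0]
    there, so the collision is a genuine singularity. *)

(** * Calculus of smooth functions *)

(** Derivatives of products, inverses and square roots contain the undifferentiated function again.
    This lets the inductions on [m] below use that function one order lower. At order 0,
    differentiability gives continuity. *)
Lemma class_C_lower (U : phase_space -> Prop) (m : nat) (F : phase_space -> R) :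
  class_C (S m) U F -> class_C m U F.
Proof.
  revert F; induction m as [|m IH]; intros F [DF [HD HDF]].
  - intros x Ux; apply (filterdiff_continuous (V := R_NormedModule)); exists (DF x); now apply HD.
  - exists DF; split; [exact HD|]; intros e; apply IH, HDF.
Qed.

Lemma class_C_const (U : phase_space -> Prop) (m : nat) (c : R) :
  class_C m U (fun _ => c).
Proof.
  revert c; induction m as [|m IH]; intros c.
  - intros x _; apply continuous_const.
  - exists (fun _ _ => 0); split.
    + intros x _; apply (filterdiff_const (c : R_NormedModule)).
    + intros e; apply IH.
Qed.

Lemma class_C_linear (U : phase_space -> Prop) (m : nat) (l : phase_space -> R) :
  is_linear (l : phase_space -> R_NormedModule) -> class_C m U l.
Proof.
  intros Hl; destruct m as [|m].
  - intros x _; apply (filterdiff_continuous (V := R_NormedModule)); exists l.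
    now apply filterdiff_linear.
  - exists (fun _ => l); split.
    + intros x _; now apply filterdiff_linear.
    + intros e; apply class_C_const.
Qed.

Lemma class_C_plus (U : phase_space -> Prop) (m : nat) (F G : phase_space -> R) :
  class_C m U F -> class_C m U G -> class_C m U (fun x => F x + G x).
Proof.
  revert F G; induction m as [|m IH]; intros F G HF HG.
  - intros x Ux.
    apply (continuous_plus (V := R_NormedModule) F G x); [now apply HF|now apply HG].
  - destruct HF as [DF [HD HDF]], HG as [DG [HE HDG]].
    exists (fun x e => DF x e + DG x e); split.
    + intros x Ux.
      apply (filterdiff_plus_fct (V := R_NormedModule) F G); [now apply HD|now apply HE].
    + intros e; now apply IH.
Qed.

Lemma class_C_mult (U : phase_space -> Prop) (m : nat) (F G : phase_space -> R) :
  class_C m U F -> class_C m U G -> class_C m U (fun x => F x * G x).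
Proof.
  revert F G; induction m as [|m IH]; intros F G HF HG.
  - intros x Ux.
    apply (continuous_mult (K := R_AbsRing) F G x); [now apply HF|now apply HG].
  - assert (HF' := class_C_lower _ _ _ HF).
    assert (HG' := class_C_lower _ _ _ HG).
    destruct HF as [DF [HD HDF]], HG as [DG [HE HDG]].
    exists (fun x e => DF x e * G x + F x * DG x e); split.
    + intros x Ux.
      apply (filterdiff_mult_fct (K := R_AbsRing) F G x (DF x) (DG x));
        [exact Rmult_comm|now apply HD|now apply HE].
    + intros e; apply class_C_plus; now apply IH.
Qed.

(** The derivative [- DF / F^2] is a product of [DF] and two copies of [/ F], to which the induction
    hypothesis applies. *)
Lemma class_C_inv (U : phase_space -> Prop) (m : nat) (F : phase_space -> R) :
  (forall x, U x -> F x <> 0) -> class_C m U F -> class_C m U (fun x => / F x).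
Proof.
  intros F0; revert F F0; induction m as [|m IH]; intros F F0 HF.
  - intros x Ux.
    apply (continuous_comp (V := R_UniformSpace) F Rinv); [now apply HF|].
    now apply continuous_Rinv, F0.
  - assert (HF' := IH F F0 (class_C_lower _ _ _ HF)).
    destruct HF as [DF [HD HDF]].
    exists (fun x e => DF x e * (-1 * (/ F x * / F x))); split.
    + intros x Ux.
      apply (filterdiff_comp' (V := R_NormedModule) (W := R_NormedModule) F Rinv x
               (DF x) (fun y => y * (-1 * (/ F x * / F x)))); [now apply HD|].
      assert (Hx := F0 x Ux).
      (* [is_derive] is [filterdiff] with the linear map [y => scal y l], so only the two linear
         maps remain to be identified. *)
      assert (Hi : is_derive Rinv (F x) (- 1 / F x ^ 2)).
      { apply (is_derive_inv (fun y => y)); [apply (is_derive_id (K := R_AbsRing))|exact Hx]. }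
      apply filterdiff_ext_lin with (1 := Hi).
      intros y; unfold scal; simpl; unfold mult; simpl; field; exact Hx.
    + intros e; apply class_C_mult; [apply HDF|].
      apply class_C_mult; [apply class_C_const|now apply class_C_mult].
Qed.

(** The derivative [DF / (2 sqrt F)] involves only [DF] and the inverse of the root, so the
    induction closes through [class_C_inv]. Positivity of [F] keeps the argument away from the
    branch point 0. *)
Lemma class_C_sqrt (U : phase_space -> Prop) (m : nat) (F : phase_space -> R) :
  (forall x, U x -> 0 < F x) -> class_C m U F -> class_C m U (fun x => sqrt (F x)).
Proof.
  intros F0; revert F F0; induction m as [|m IH]; intros F F0 HF.
  - intros x Ux.
    apply (continuous_comp (V := R_UniformSpace) F sqrt); [now apply HF|].
    apply continuous_sqrt.
  - assert (HF' := IH F F0 (class_C_lower _ _ _ HF)).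
    destruct HF as [DF [HD HDF]].
    exists (fun x e => DF x e * / (2 * sqrt (F x))); split.
    + intros x Ux.
      apply (filterdiff_comp' (V := R_NormedModule) (W := R_NormedModule) F sqrt x
               (DF x) (fun y => y * / (2 * sqrt (F x)))); [now apply HD|].
      assert (Hx := F0 x Ux).
      assert (Hi : is_derive sqrt (F x) (1 / (2 * sqrt (F x)))).
      { apply (is_derive_sqrt (fun y => y)); [apply (is_derive_id (K := R_AbsRing))|exact Hx]. }
      apply filterdiff_ext_lin with (1 := Hi).
      intros y; unfold scal; simpl; unfold mult; simpl; field.
      now apply Rgt_not_eq, sqrt_lt_R0.
    + intros e; apply class_C_mult; [apply HDF|].
      apply class_C_inv.
      * intros x Ux; apply Rgt_not_eq.
        apply Rmult_lt_0_compat; [lra|]; now apply sqrt_lt_R0, F0.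
      * apply class_C_mult; [apply class_C_const|exact HF'].
Qed.

Lemma smooth_const (U : phase_space -> Prop) (c : R) : smooth_on U (fun _ => c).
Proof. intros m; apply class_C_const. Qed.

Lemma smooth_plus (U : phase_space -> Prop) (F G : phase_space -> R) :
  smooth_on U F -> smooth_on U G -> smooth_on U (fun x => F x + G x).
Proof. intros HF HG m; now apply class_C_plus. Qed.

Lemma smooth_mult (U : phase_space -> Prop) (F G : phase_space -> R) :
  smooth_on U F -> smooth_on U G -> smooth_on U (fun x => F x * G x).
Proof. intros HF HG m; now apply class_C_mult. Qed.

Lemma smooth_opp (U : phase_space -> Prop) (F : phase_space -> R) :
  smooth_on U F -> smooth_on U (fun x => - F x).
Proof.
  intros HF; replace (fun x => - F x) with (fun x => -1 * F x).
  - apply smooth_mult; [apply smooth_const|exact HF].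
  - apply functional_extensionality; intros x; ring.
Qed.

Lemma smooth_minus (U : phase_space -> Prop) (F G : phase_space -> R) :
  smooth_on U F -> smooth_on U G -> smooth_on U (fun x => F x - G x).
Proof. intros HF HG; apply smooth_plus; [|apply smooth_opp]; assumption. Qed.

Lemma smooth_pow (U : phase_space -> Prop) (F : phase_space -> R) (p : nat) :
  smooth_on U F -> smooth_on U (fun x => F x ^ p).
Proof.
  intros HF; induction p as [|p IH]; simpl.
  - apply smooth_const.
  - now apply smooth_mult.
Qed.

Lemma smooth_div (U : phase_space -> Prop) (F G : phase_space -> R) :
  (forall x, U x -> G x <> 0) ->
  smooth_on U F -> smooth_on U G -> smooth_on U (fun x => F x / G x).
Proof.
  intros G0 HF HG m; apply class_C_mult; [apply HF|].
  apply class_C_inv; [exact G0|apply HG].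
Qed.

Lemma smooth_sum (U : phase_space -> Prop) (F : nat -> phase_space -> R) (p q : nat) :
  (forall j, (p <= j <= q)%nat -> smooth_on U (F j)) ->
  smooth_on U (fun x => sum_n_m (fun j => F j x) p q).
Proof.
  destruct (Nat.le_gt_cases p q) as [Hpq|Hpq].
  - induction Hpq as [|q Hpq IH]; intros HF.
    + replace (fun x => sum_n_m (fun j => F j x) p p) with (F p).
      * apply HF; lia.
      * apply functional_extensionality; intros x; now rewrite sum_n_n.
    + replace (fun x => sum_n_m (fun j => F j x) p (S q))
        with (fun x => sum_n_m (fun j => F j x) p q + F (S q) x).
      * apply smooth_plus; [apply IH; intros j Hj|]; apply HF; lia.
      * apply functional_extensionality; intros x.
        now rewrite sum_n_Sm by lia.
  - intros _.
    replace (fun x => sum_n_m (fun j => F j x) p q) with (fun _ : phase_space => 0).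
    + apply smooth_const.
    + apply functional_extensionality; intros x; now rewrite sum_n_m_zero.
Qed.

(** * Smoothness of complex-valued functions and of moduli *)

Definition csmooth (U : phase_space -> Prop) (F : phase_space -> C) : Prop :=
  smooth_on U (fun x => Re (F x)) /\ smooth_on U (fun x => Im (F x)).

Lemma csmooth_const (U : phase_space -> Prop) (c : C) : csmooth U (fun _ => c).
Proof. split; apply smooth_const. Qed.

Lemma is_linear_Re_Im :
  is_linear (Re : C_R_NormedModule -> R_NormedModule) /\
  is_linear (Im : C_R_NormedModule -> R_NormedModule).
Proof.
  split.
  - apply (is_linear_fst (U := R_NormedModule) (V := R_NormedModule)).
  - apply (is_linear_snd (U := R_NormedModule) (V := R_NormedModule)).
Qed.

Lemma csmooth_linear (U : phase_space -> Prop) (l : phase_space -> C) :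
  is_linear (l : phase_space -> C_R_NormedModule) -> csmooth U l.
Proof.
  intros Hl; split; intros m; apply class_C_linear.
  - apply (is_linear_comp l (Re : C_R_NormedModule -> R_NormedModule) Hl).
    apply is_linear_Re_Im.
  - apply (is_linear_comp l (Im : C_R_NormedModule -> R_NormedModule) Hl).
    apply is_linear_Re_Im.
Qed.

Lemma csmooth_position (U : phase_space -> Prop) : csmooth U (fun x => fst x).
Proof. apply csmooth_linear, is_linear_fst. Qed.

Lemma csmooth_momentum (U : phase_space -> Prop) : csmooth U (fun x => snd x).
Proof. apply csmooth_linear, is_linear_snd. Qed.

Lemma csmooth_plus (U : phase_space -> Prop) (F G : phase_space -> C) :
  csmooth U F -> csmooth U G -> csmooth U (fun x => F x + G x)%C.
Proof. intros [] []; split; now apply smooth_plus. Qed.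

Lemma csmooth_opp (U : phase_space -> Prop) (F : phase_space -> C) :
  csmooth U F -> csmooth U (fun x => - F x)%C.
Proof. intros []; split; now apply smooth_opp. Qed.

Lemma csmooth_minus (U : phase_space -> Prop) (F G : phase_space -> C) :
  csmooth U F -> csmooth U G -> csmooth U (fun x => F x - G x)%C.
Proof. intros HF HG; apply csmooth_plus; [|apply csmooth_opp]; assumption. Qed.

Lemma csmooth_mult (U : phase_space -> Prop) (F G : phase_space -> C) :
  csmooth U F -> csmooth U G -> csmooth U (fun x => F x * G x)%C.
Proof.
  intros [] []; split; [apply smooth_minus|apply smooth_plus]; now apply smooth_mult.
Qed.

Lemma csmooth_conj (U : phase_space -> Prop) (F : phase_space -> C) :
  csmooth U F -> csmooth U (fun x => Cconj (F x)).
Proof. intros []; split; [|apply smooth_opp]; assumption. Qed.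

Lemma smooth_Cmod_sqr (U : phase_space -> Prop) (F : phase_space -> C) :
  csmooth U F -> smooth_on U (fun x => Cmod (F x) ^ 2).
Proof.
  intros [HR HI].
  replace (fun x => Cmod (F x) ^ 2) with (fun x => Re (F x) ^ 2 + Im (F x) ^ 2).
  - apply smooth_plus; now apply smooth_pow.
  - apply functional_extensionality; intros x.
    unfold Cmod; rewrite pow2_sqrt; [reflexivity|].
    apply Rplus_le_le_0_compat; apply pow2_ge_0.
Qed.

Lemma smooth_Cmod (U : phase_space -> Prop) (F : phase_space -> C) :
  (forall x, U x -> F x <> 0%C) -> csmooth U F -> smooth_on U (fun x => Cmod (F x)).
Proof.
  intros F0 HF m.
  replace (fun x => Cmod (F x)) with (fun x => sqrt (Cmod (F x) ^ 2)).
  - apply class_C_sqrt; [|now apply smooth_Cmod_sqr].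
    intros x Ux; now apply pow_lt, Cmod_gt_0, F0.
  - apply functional_extensionality; intros x.
    apply sqrt_pow2, Cmod_ge_0.
Qed.

(** * Positions of the primaries *)

(** On the sphere [r > 0] forces [z^2 < 1]. On the upper sheet of the hyperboloid [z^2 = 1 + r^2]
    gives [z > 1]. *)
Lemma pole_bounds (sigma r z : R) :
  sigma = 1 \/ sigma = -1 -> 0 < r -> r ^ 2 + sigma * z ^ 2 = sigma ->
  (sigma = -1 -> 0 < z) -> 0 < 1 + z /\ 1 - z <> 0.
Proof.
  intros [->| ->] Hr Hsurface Hsheet.
  - split; nra.
  - specialize (Hsheet eq_refl); split; nra.
Qed.

Lemma vertex_sqr (n : nat) (r : R) (j : nat) :
  kcoord n r j ^ 2 + hcoord n r j ^ 2 = r ^ 2.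
Proof.
  unfold kcoord, hcoord.
  set (t := 2 * PI * (INR j - 1) / INR n).
  generalize (sin2_cos2 t); unfold Rsqr; intros E.
  transitivity (r ^ 2 * (sin t * sin t + cos t * cos t)); [ring|rewrite E; ring].
Qed.

Lemma primary_coord (n : nat) (r z : R) (j : nat) : 1 + z <> 0 ->
  primary n r z j = (kcoord n r j / (1 + z), hcoord n r j / (1 + z)).
Proof.
  intros H; unfold primary, Cdiv, Cmult, Cplus, Cinv, RtoC, Ci; simpl.
  f_equal; field; nra.
Qed.

Lemma antiprimary_coord (n : nat) (r z : R) (j : nat) : 1 - z <> 0 ->
  antiprimary n r z j = (- (kcoord n r j / (1 - z)), - (hcoord n r j / (1 - z))).
Proof.
  intros H; unfold antiprimary, Cdiv, Copp, Cmult, Cplus, Cinv, RtoC, Ci; simpl.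
  f_equal; field; nra.
Qed.

Lemma Cmod_sqr (q : C) : Cmod q ^ 2 = fst q ^ 2 + snd q ^ 2.
Proof.
  unfold Cmod; apply pow2_sqrt, Rplus_le_le_0_compat; apply pow2_ge_0.
Qed.

Lemma Cmod_primary_sqr (n : nat) (r z : R) (j : nat) : 1 + z <> 0 ->
  Cmod (primary n r z j) ^ 2 = r ^ 2 / (1 + z) ^ 2.
Proof.
  intros H; rewrite Cmod_sqr, primary_coord, <- (vertex_sqr n r j) by exact H.
  simpl; field; exact H.
Qed.

Lemma Cmod_antiprimary_sqr (n : nat) (r z : R) (j : nat) : 1 - z <> 0 ->
  Cmod (antiprimary n r z j) ^ 2 = r ^ 2 / (1 - z) ^ 2.
Proof.
  intros H; rewrite Cmod_sqr, antiprimary_coord, <- (vertex_sqr n r j) by exact H.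
  simpl; field; exact H.
Qed.

(** The moduli are [r / |1 + z|] and [r / |1 - z|]; they agree only if [(1 - z)^2 = (1 + z)^2], that
    is [z = 0]. *)
Lemma primary_neq_antiprimary (n : nat) (r z : R) (i j : nat) :
  0 < r -> z <> 0 -> 1 + z <> 0 -> 1 - z <> 0 ->
  primary n r z i <> antiprimary n r z j.
Proof.
  intros Hr Hz Hp Hm E.
  assert (Er : r ^ 2 / (1 + z) ^ 2 = r ^ 2 / (1 - z) ^ 2).
  { rewrite <- (Cmod_primary_sqr n r z i), <- (Cmod_antiprimary_sqr n r z j) by assumption.
    now rewrite E. }
  assert (Er' : r ^ 2 * (1 - z) ^ 2 = r ^ 2 * (1 + z) ^ 2).
  { transitivity (r ^ 2 / (1 + z) ^ 2 * ((1 + z) ^ 2 * (1 - z) ^ 2)).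
    - field; exact Hp.
    - rewrite Er; field; exact Hm. }
  apply Rmult_eq_reg_l in Er'; [apply Hz; lra|nra].
Qed.

(** The hypotheses give [cos (a - b) = 1], hence [sin ((a - b) / 2) = 0]. The half difference lies
    strictly between [- PI] and [PI], where the sine vanishes only at 0. *)
Lemma cos_sin_inj (a b : R) :
  Rabs (a - b) < 2 * PI -> cos a = cos b -> sin a = sin b -> a = b.
Proof.
  intros Hab Ec Es; apply Rabs_def2 in Hab.
  assert (E : cos (2 * ((a - b) / 2)) = 1).
  { replace (2 * ((a - b) / 2)) with (a - b) by field.
    rewrite cos_minus, Ec, Es, Rplus_comm; apply sin2_cos2. }
  rewrite cos_2a_sin in E.
  assert (S0 : sin ((a - b) / 2) = 0) by nra.
  destruct (Rtotal_order a b) as [Hlt|[Heq|Hgt]]; [|exact Heq|].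
  - assert (0 < sin (- ((a - b) / 2))) by (apply sin_gt_0; lra).
    rewrite sin_neg in H; lra.
  - assert (0 < sin ((a - b) / 2)) by (apply sin_gt_0; lra); lra.
Qed.

Lemma primary_inj (n : nat) (r z : R) (i j : nat) :
  0 < r -> 1 + z <> 0 -> (1 <= i <= n)%nat -> (1 <= j <= n)%nat ->
  primary n r z i = primary n r z j -> i = j.
Proof.
  intros Hr Hp Hi Hj E; rewrite !primary_coord in E by exact Hp.
  injection E; unfold kcoord, hcoord; intros Es Ec.
  assert (Hn : 0 < INR n) by (apply lt_0_INR; lia).
  assert (Ea : 2 * PI * (INR i - 1) / INR n = 2 * PI * (INR j - 1) / INR n).
  { apply cos_sin_inj.
    (* Two indices between 1 and [n] differ by less than [n], so the two angles differ by less than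
       a full turn. *)
    - replace (2 * PI * (INR i - 1) / INR n - 2 * PI * (INR j - 1) / INR n)
        with (2 * PI * ((INR i - INR j) / INR n)) by (field; lra).
      assert (HPI := PI_RGT_0).
      rewrite Rabs_mult, (Rabs_pos_eq (2 * PI)) by lra.
      rewrite <- (Rmult_1_r (2 * PI)) at 2; apply Rmult_lt_compat_l; [lra|].
      rewrite Rabs_div, (Rabs_pos_eq (INR n)) by lra.
      apply Rlt_div_l; [exact Hn|]; rewrite Rmult_1_l.
      assert (1 <= INR i /\ INR i <= INR n /\ 1 <= INR j /\ INR j <= INR n).
      { repeat split; try (apply le_INR; lia); apply (le_INR 1); lia. }
      apply Rabs_def1; lra.
    - apply Rmult_eq_reg_l with r; [|lra]; apply Rmult_eq_reg_r with (/ (1 + z)); [exact Ec|].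
      now apply Rinv_neq_0_compat.
    - apply Rmult_eq_reg_l with r; [|lra]; apply Rmult_eq_reg_r with (/ (1 + z)); [exact Es|].
      now apply Rinv_neq_0_compat. }
  assert (HPI := PI_RGT_0).
  apply INR_eq.
  replace (INR i) with (2 * PI * (INR i - 1) / INR n * (INR n / (2 * PI)) + 1)
    by (field; lra).
  rewrite Ea; field; lra.
Qed.

(** * The regularized Hamiltonian *)

(** Numerator of the j-th summand of [potential]. It is [1 + sigma |q|^2] times the ambient inner
    product, of signature [(1, 1, sigma)], of the j-th primary with the point of the surface
    projecting to [q]. *)
Definition attraction (sigma : R) (n : nat) (r z : R) (j : nat) (q : C) : R :=
  Re (RtoC (kcoord n r j) * (q + Cconj q)
      - Ci * RtoC (hcoord n r j) * (q - Cconj q))%C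
  + sigma * z * (1 - sigma * (Cmod q) ^ 2).

(** The inner product of a primary with itself is [sigma] by the surface equation, and [1 + sigma
    |w_j|^2 = 1 + (1 - z) / (1 + z) = 2 / (1 + z)]. *)
Lemma attraction_primary (sigma : R) (n : nat) (r z : R) (j : nat) :
  sigma = 1 \/ sigma = -1 -> r ^ 2 + sigma * z ^ 2 = sigma -> 1 + z <> 0 ->
  attraction sigma n r z j (primary n r z j) = 2 * sigma / (1 + z).
Proof.
  intros Hsigma Hsurface Hp; unfold attraction.
  rewrite Cmod_primary_sqr, primary_coord by exact Hp.
  simpl Re; unfold Cconj; simpl.
  transitivity (2 * (kcoord n r j ^ 2 + hcoord n r j ^ 2) / (1 + z)
                + sigma * z * (1 - sigma * (r ^ 2 / (1 + z) ^ 2))).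
  { field; exact Hp. }
  rewrite vertex_sqr.
  replace (r ^ 2) with (sigma * (1 - z ^ 2)) by lra.
  replace (sigma * (sigma * (1 - z ^ 2) / (1 + z) ^ 2))
    with (sigma ^ 2 * ((1 - z) / (1 + z))) by (field; exact Hp).
  replace (sigma ^ 2) with 1 by (destruct Hsigma as [->| ->]; ring).
  field; exact Hp.
Qed.

Definition collision_map (n : nat) (r z : R) (k : nat) (w : C) : C :=
  (w * Cconj w + primary n r z k)%C.

(* [Cmod w ^ 2] times the potential: the factor cancels [|q - w_k|] in the k-th
   summand. *)
Definition regularized_potential (sigma : R) (n : nat) (r z : R) (k : nat) (w : C) : R :=
  let q := collision_map n r z k w in
  sum_n_m (fun j : nat =>
    (if Nat.eqb j k then 1 else Cmod w ^ 2 / Cmod (q - primary n r z j)%C) *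
    (attraction sigma n r z j q / (r * Cmod (q - antiprimary n r z j)%C))) 1 n.

(** All divisions by [w] have been carried out; the remaining ones are by distances that stay
    positive at [w = 0]. This formula is the smooth extension of hat H. *)
Definition regularized_hamiltonian (sigma : R) (n : nat) (r z Omega : R) (k : nat)
    (Cst : R) (w W : C) : R :=
  let q := collision_map n r z k w in
  (1 + sigma * Cmod q ^ 2) ^ 2 / 4 * Cmod W ^ 2
  + 2 * Omega * Im (q * (Cconj W * w))%C
  - 2 * regularized_potential sigma n r z k w
  + Cst / 2 * Cmod w ^ 2.

Lemma Cmod_minus_neq_0 (p q : C) : p <> q -> Cmod (p - q)%C <> 0.
Proof. intros H; now apply Rgt_not_eq, Cmod_gt_0, Cminus_eq_contra. Qed.

Lemma regularized_potential_eq (sigma : R) (n : nat) (r z : R) (k : nat) (w : C) :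
  0 < r -> w <> 0%C ->
  configuration_space sigma n r z (collision_map n r z k w) ->
  regularized_potential sigma n r z k w
  = Cmod w ^ 2 * potential sigma n r z (collision_map n r z k w).
Proof.
  intros Hr Hw [_ HQ]; unfold regularized_potential, potential.
  rewrite <- (sum_n_m_mult_l (K := R_Ring)).
  apply (sum_n_m_ext_loc (G := R_AbelianMonoid)); intros j Hj.
  destruct (HQ j Hj) as [Hwj Haj].
  assert (Hd := Cmod_minus_neq_0 _ _ Hwj).
  assert (He := Cmod_minus_neq_0 _ _ Haj).
  (* The abstract ring product left by [sum_n_m_mult_l] is restated as the product of reals, for
     [field]. *)
  lazymatch goal with |- ?a = mult ?b ?c => change (a = b * c :> R) end.
  fold (attraction sigma n r z j (collision_map n r z k w)).
  destruct (Nat.eqb_spec j k) as [->|Hjk].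
  - assert (Ed : Cmod (collision_map n r z k w - primary n r z k)%C = Cmod w ^ 2).
    { unfold collision_map.
      replace (w * Cconj w + primary n r z k - primary n r z k)%C with (w * Cconj w)%C by ring.
      rewrite Cmod_mult, Cmod_conj; ring. }
    rewrite <- Ed; field; repeat split; lra.
  - field; repeat split; lra.
Qed.

Lemma transformed_hamiltonian_eq (sigma : R) (n : nat) (r z Omega : R) (k : nat)
    (Cst : R) (w W : C) :
  0 < r -> w <> 0%C ->
  configuration_space sigma n r z (collision_map n r z k w) ->
  transformed_hamiltonian (hamiltonian sigma n r z Omega) (collision_map n r z k)
    (fun w => Cconj w) Cst w W
  = regularized_hamiltonian sigma n r z Omega k Cst w W.
Proof.
  intros Hr Hw HQ; unfold transformed_hamiltonian, regularized_hamiltonian, hamiltonian.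
  rewrite regularized_potential_eq, Cconj_conj, Cmod_conj by assumption.
  set (q := collision_map n r z k w).
  assert (Hm : Cmod w <> 0) by (intros E; now apply Hw, Cmod_eq_0).
  rewrite Cmod_div by exact Hw.
  (* With [|w|^2 = w * Cconj w], the factor [Cconj w] cancels the denominator of [Cconj (W / w)] and
     leaves [Cconj W * w]. *)
  assert (HI : Im (q * (Cconj W * w))%C = Cmod w ^ 2 * Im (q * Cconj (W / w))%C).
  { rewrite <- im_scal_l.
    f_equal; rewrite Cmod2_conj, Cdiv_conj by exact Hw.
    field.
    intros E; apply Hm; rewrite <- Cmod_conj, E; apply Cmod_0. }
  rewrite HI; field; exact Hm.
Qed.

Lemma csmooth_collision_map (U : phase_space -> Prop) (n : nat) (r z : R) (k : nat) :
  csmooth U (fun x => collision_map n r z k (fst x)).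
Proof.
  apply csmooth_plus; [|apply csmooth_const].
  apply csmooth_mult; [|apply csmooth_conj]; apply csmooth_position.
Qed.

Lemma smooth_attraction (U : phase_space -> Prop) (sigma : R) (n : nat) (r z : R)
    (j : nat) (q : phase_space -> C) :
  csmooth U q -> smooth_on U (fun x => attraction sigma n r z j (q x)).
Proof.
  intros Hq; apply smooth_plus.
  - apply (csmooth_minus U
             (fun x => RtoC (kcoord n r j) * (q x + Cconj (q x)))%C
             (fun x => Ci * RtoC (hcoord n r j) * (q x - Cconj (q x)))%C).
    + apply csmooth_mult; [apply csmooth_const|].
      apply csmooth_plus; [|apply csmooth_conj]; exact Hq.
    + apply csmooth_mult; [apply csmooth_const|].
      apply csmooth_minus; [|apply csmooth_conj]; exact Hq.
  - apply smooth_mult; [apply smooth_const|].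
    apply smooth_minus; [apply smooth_const|].
    apply smooth_mult; [apply smooth_const|now apply smooth_Cmod_sqr].
Qed.

(** The k-th primary is allowed as a position: its distance no longer occurs as a denominator. Hence
    [U] may contain the points with [w = 0]. *)
Lemma smooth_regularized_hamiltonian (U : phase_space -> Prop) (sigma : R) (n : nat)
    (r z Omega : R) (k : nat) (Cst : R) :
  0 < r ->
  (forall x j, U x -> (1 <= j <= n)%nat ->
     (j <> k -> collision_map n r z k (fst x) <> primary n r z j) /\
     collision_map n r z k (fst x) <> antiprimary n r z j) ->
  smooth_on U (fun x => regularized_hamiltonian sigma n r z Omega k Cst (fst x) (snd x)).
Proof.
  intros Hr HU.
  assert (Hq := csmooth_collision_map U n r z k).
  assert (Hw := csmooth_position U).
  assert (HW := csmooth_momentum U).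
  apply smooth_plus; [apply smooth_minus; [apply smooth_plus|]|].
  - apply smooth_mult; [|now apply smooth_Cmod_sqr].
    apply smooth_mult; [|apply smooth_const].
    apply smooth_pow, smooth_plus; [apply smooth_const|].
    apply smooth_mult; [apply smooth_const|now apply smooth_Cmod_sqr].
  - apply smooth_mult; [apply smooth_const|].
    apply (csmooth_mult U (fun x => collision_map n r z k (fst x))
             (fun x => Cconj (snd x) * fst x)%C); [exact Hq|].
    apply csmooth_mult; [apply csmooth_conj|]; assumption.
  - apply smooth_mult; [apply smooth_const|].
    apply smooth_sum; intros j Hj; apply smooth_mult.
    + destruct (Nat.eqb_spec j k) as [_|Hjk]; [apply smooth_const|].
      apply smooth_div.
      * intros x Ux; apply Cmod_minus_neq_0; now apply (HU x j Ux Hj).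
      * now apply smooth_Cmod_sqr.
      * apply smooth_Cmod.
        -- intros x Ux; apply Cminus_eq_contra; now apply (HU x j Ux Hj).
        -- apply csmooth_minus; [exact Hq|apply csmooth_const].
    + apply smooth_div.
      * intros x Ux; apply Rmult_integral_contrapositive_currified; [lra|].
        apply Cmod_minus_neq_0; now apply (HU x j Ux Hj).
      * now apply smooth_attraction.
      * apply smooth_mult; [apply smooth_const|].
        apply smooth_Cmod.
        -- intros x Ux; apply Cminus_eq_contra; now apply (HU x j Ux Hj).
        -- apply csmooth_minus; [exact Hq|apply csmooth_const].
  - apply smooth_mult; [apply smooth_const|now apply smooth_Cmod_sqr].
Qed.

(** * Approach to the collision along real [w = t], with [t] decreasing to 0 *)

Lemma collision_map_RtoC (n : nat) (r z : R) (k : nat) (t : R) :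
  collision_map n r z k (RtoC t) = (RtoC (t ^ 2) + primary n r z k)%C.
Proof.
  unfold collision_map; f_equal.
  rewrite <- Cmod2_conj, Cmod_R, pow2_abs; reflexivity.
Qed.

(** Since [|g w - w_k| = |w|^2], the collision corresponds to a single point of the [w]-plane. *)
Lemma collision_map_eq_primary (n : nat) (r z : R) (k : nat) (w : C) :
  collision_map n r z k w = primary n r z k <-> w = 0%C.
Proof.
  unfold collision_map; split; [intros E|intros ->; ring].
  apply Cmod_eq_0.
  assert (E0 : Cmod (w * Cconj w) = 0).
  { rewrite <- Cmod_0; f_equal.
    transitivity (w * Cconj w + primary n r z k - primary n r z k)%C; [ring|].
    rewrite E; ring. }
  rewrite Cmod_mult, Cmod_conj in E0; nra.
Qed.

Lemma at_right_0_bound (d : R) : 0 < d -> at_right 0 (fun t => 0 < t < d).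
Proof.
  intros Hd; exists (mkposreal d Hd); intros t Ht Ht0; split; [exact Ht0|].
  unfold ball in Ht; simpl in Ht; unfold AbsRing_ball, abs, minus, plus, opp in Ht.
  simpl in Ht; apply Rabs_def2 in Ht; lra.
Qed.

Lemma at_right_0_avoid (n : nat) (r z : R) (k : nat) (p : C) :
  at_right 0 (fun t => collision_map n r z k (RtoC t) <> p).
Proof.
  destruct (Ceq_dec p (primary n r z k)) as [->|Hp].
  - apply filter_imp with (2 := at_right_0_bound 1 Rlt_0_1).
    intros t [Ht _] E; apply collision_map_eq_primary, RtoC_inj in E; lra.
  - apply Cminus_eq_contra, Cmod_gt_0 in Hp.
    (* The bound 1 gives [t^2 < t], so the displacement [t^2] from [w_k] stays below the distance
       from [w_k] to [p]. *)
    apply filter_imp with (2 := at_right_0_bound _ (Rmin_pos _ _ Rlt_0_1 Hp)).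
    intros t [Ht0 Ht] E.
    assert (Ht1 := Rlt_le_trans _ _ _ Ht (Rmin_l _ _)).
    assert (Htp := Rlt_le_trans _ _ _ Ht (Rmin_r _ _)).
    rewrite <- E, collision_map_RtoC in Htp.
    replace (RtoC (t ^ 2) + primary n r z k - primary n r z k)%C with (RtoC (t ^ 2)) in Htp by ring.
    rewrite Cmod_R, Rabs_pos_eq in Htp; nra.
Qed.

Lemma filter_forall_le {T : Type} (F : (T -> Prop) -> Prop) {FF : Filter F}
    (P : nat -> T -> Prop) (m : nat) :
  (forall j, (j <= m)%nat -> F (P j)) -> F (fun t => forall j, (j <= m)%nat -> P j t).
Proof.
  induction m as [|m IH]; intros H.
  - apply filter_imp with (2 := H O (le_n O)); intros t Ht j Hj.
    now replace j with O by lia.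
  - assert (H1 := IH (fun j Hj => H j (le_S _ _ Hj))).
    apply filter_imp with (2 := filter_and _ _ H1 (H (S m) (le_n _))).
    intros t [Ht Htm] j Hj.
    destruct (Nat.eq_dec j (S m)) as [->|Hjm]; [exact Htm|apply Ht; lia].
Qed.

(** Here [|w_j|^2 = (z^2 - 1) / (1 + z)^2 = (z - 1) / (z + 1)], which is below 1. *)
Lemma primary_in_disk (n : nat) (r z : R) (j : nat) :
  0 < z -> r ^ 2 + -1 * z ^ 2 = -1 -> Cmod (primary n r z j) < 1.
Proof.
  intros Hz Hsurface.
  assert (Hm := Cmod_ge_0 (primary n r z j)).
  assert (E : Cmod (primary n r z j) ^ 2 * (1 + z) = z - 1).
  { rewrite Cmod_primary_sqr by lra.
    replace (r ^ 2) with (z ^ 2 - 1) by lra; field; lra. }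
  apply Rnot_le_lt; intros Hle.
  assert (1 <= Cmod (primary n r z j) ^ 2) by nra; nra.
Qed.

Lemma at_right_0_configuration (sigma : R) (n : nat) (r z : R) (k : nat) :
  r ^ 2 + sigma * z ^ 2 = sigma -> (sigma = -1 -> 0 < z) ->
  at_right 0 (fun t =>
    configuration_space sigma n r z (collision_map n r z k (RtoC t))).
Proof.
  intros Hsurface Hsheet; apply filter_and.
  - destruct (Req_dec sigma (-1)) as [Hs|Hs].
    + assert (Hk : Cmod (primary n r z k) < 1).
      { apply primary_in_disk; [now apply Hsheet|now rewrite <- Hs]. }
      apply filter_imp
        with (2 := at_right_0_bound (1 - Cmod (primary n r z k)) ltac:(lra)).
      intros t Ht _; rewrite collision_map_RtoC.
      apply Rle_lt_trans with (1 := Cmod_triangle _ _).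
      rewrite Cmod_R, Rabs_pos_eq by nra.
      assert (Hm := Cmod_ge_0 (primary n r z k)); nra.
    + apply filter_forall; intros t Hs'; now destruct Hs.
  (* Index 0, which numbers no primary, is included to fit [filter_forall_le]; avoidance holds for
     any point of the plane. *)
  - apply filter_imp with (P := fun t => forall j, (j <= n)%nat ->
      collision_map n r z k (RtoC t) <> primary n r z j /\
      collision_map n r z k (RtoC t) <> antiprimary n r z j).
    + intros t Ht j Hj; apply Ht; lia.
    + apply filter_forall_le; [typeclasses eauto|].
      intros j _; apply filter_and; apply at_right_0_avoid.
Qed.

(** Carries an identity known only for [t > 0], where hat H is defined, to the collision at
    [t = 0]. *)
Lemma at_right_limit_unique (f g : R -> R) (a : R) :
  at_right a (fun t => f t = g t) -> continuous f a -> continuous g a -> f a = g a.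
Proof.
  intros Hfg Hf Hg.
  apply (filterlim_locally_unique (K := R_AbsRing) (V := R_NormedModule)
           (F := at_right a) g).
  - apply filterlim_ext_loc with (1 := Hfg).
    apply filterlim_filter_le_1 with (2 := Hf); apply filter_le_within.
  - apply filterlim_filter_le_1 with (2 := Hg); apply filter_le_within.
Qed.

Lemma continuous_pair {T V W : UniformSpace} (f : T -> V) (g : T -> W) (x : T) :
  continuous f x -> continuous g x ->
  continuous (fun t => (f t, g t) : prod_UniformSpace V W) x.
Proof.
  intros Hf Hg.
  apply (continuous_comp_2 (X := prod_UniformSpace V W) f g pair x Hf Hg).
  apply continuous_ext with (f := fun p => p); [|apply continuous_id].
  now intros [].
Qed.

Lemma continuous_at_rest (F : phase_space -> R) (f g : R -> R) (t : R) :
  continuous f t -> continuous g t ->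
  continuous F ((f t, g t), RtoC 0) ->
  continuous (fun s => F ((f s, g s), RtoC 0)) t.
Proof.
  intros Hf Hg HF.
  apply (continuous_comp (V := phase_space) (fun s => ((f s, g s), RtoC 0)) F); [|exact HF].
  apply (continuous_pair (V := C_R_NormedModule) (W := C_R_NormedModule)
           (fun s => (f s, g s))).
  - now apply (continuous_pair (V := R_UniformSpace) (W := R_UniformSpace)).
  - apply continuous_const.
Qed.

Lemma sum_n_m_single (a : nat -> R) (p q k : nat) :
  (p <= k <= q)%nat -> (forall j, j <> k -> a j = 0) -> sum_n_m a p q = a k.
Proof.
  intros [Hpk Hkq] Ha.
  induction Hkq as [|q Hkq IH].
  - destruct k as [|k].
    + now replace p with O by lia; rewrite sum_n_n.
    + destruct (Nat.eq_dec p (S k)) as [->|Hne]; [apply sum_n_n|].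
      rewrite sum_n_Sm by lia.
      rewrite (sum_n_m_ext_loc (G := R_AbelianMonoid) a (fun _ => zero))
        by (intros j Hj; apply Ha; lia).
      rewrite sum_n_m_const_zero; apply plus_zero_l.
  - rewrite sum_n_Sm, IH, (Ha (S q)) by lia; apply Rplus_0_r.
Qed.

(** The value is [- 4 sigma / ((1 + z) r d)], where [d] is the distance from [w_k] to the k-th
    antiprimary. *)
Lemma regularized_hamiltonian_at_collision (sigma : R) (n : nat) (r z Omega : R) (k : nat) :
  sigma = 1 \/ sigma = -1 -> 0 < r -> r ^ 2 + sigma * z ^ 2 = sigma ->
  1 + z <> 0 -> primary n r z k <> antiprimary n r z k -> (1 <= k <= n)%nat ->
  regularized_hamiltonian sigma n r z Omega k 0 (RtoC 0) (RtoC 0) <> 0.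
Proof.
  intros Hsigma Hr Hsurface Hp Hka Hk.
  assert (HS : regularized_potential sigma n r z k (RtoC 0)
    = 2 * sigma / (1 + z) / (r * Cmod (primary n r z k - antiprimary n r z k)%C)).
  { unfold regularized_potential.
    rewrite (proj2 (collision_map_eq_primary n r z k (RtoC 0)) eq_refl).
    rewrite sum_n_m_single with (k := k); [|exact Hk|].
    - rewrite Nat.eqb_refl, attraction_primary by assumption; apply Rmult_1_l.
    - intros j Hj; apply Nat.eqb_neq in Hj; rewrite Hj, Cmod_0; unfold Rdiv; ring. }
  unfold regularized_hamiltonian; rewrite HS, Cmod_0, Cmult_0_r, Cmult_0_r.
  simpl Im.
  apply Cmod_minus_neq_0 in Hka.
  set (d := Cmod _) in *.
  intros E.
  assert (E' : sigma * (4 / ((1 + z) * (r * d))) = 0).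
  { rewrite <- Ropp_0, <- E; field; repeat split; lra. }
  apply Rmult_integral in E'; destruct E' as [E'|E'].
  - destruct Hsigma; lra.
  - revert E'; unfold Rdiv; apply Rmult_integral_contrapositive_currified; [lra|].
    apply Rinv_neq_0_compat; repeat apply Rmult_integral_contrapositive_currified; lra.
Qed.

Lemma hamiltonian_singular (sigma : R) (n : nat) (r z Omega : R) (k : nat) :
  sigma = 1 \/ sigma = -1 -> 0 < r -> r ^ 2 + sigma * z ^ 2 = sigma ->
  (sigma = -1 -> 0 < z) -> 1 + z <> 0 -> (1 <= k <= n)%nat ->
  (forall j, (1 <= j <= n)%nat ->
     (j <> k -> primary n r z k <> primary n r z j) /\
     primary n r z k <> antiprimary n r z j) ->
  ~ extends_smoothly (configuration_space sigma n r z)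
      (fun q => configuration_space sigma n r z q \/ q = primary n r z k)
      (hamiltonian sigma n r z Omega).
Proof.
  intros Hsigma Hr Hsurface Hsheet Hp Hk Hdist [Fext [HF Heq]].
  set (a := primary n r z k) in *.
  set (Hreg := fun x : phase_space =>
    regularized_hamiltonian sigma n r z Omega k 0 (fst x) (snd x)).
  assert (HC : continuous Hreg (RtoC 0, RtoC 0)).
  { assert (HS : smooth_on (fun x => x = (RtoC 0, RtoC 0)) Hreg).
    2: exact (HS O _ eq_refl).
    apply smooth_regularized_hamiltonian; [exact Hr|].
    intros x j -> Hj; simpl fst.
    rewrite (proj2 (collision_map_eq_primary n r z k (RtoC 0)) eq_refl).
    now apply Hdist. }
  apply (regularized_hamiltonian_at_collision sigma n r z Omega k);
    try assumption; [now apply Hdist|].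
  change (Hreg ((0, 0), RtoC 0) = 0).
  (* The right-hand 0 is written as the value at [t = 0] of [t^2 * Fext], taken at the position
     [w_k + t^2] with zero momentum. For small [t > 0] this is hat H at [w = t], [W = 0]. *)
  transitivity (0 ^ 2 * Fext ((0 ^ 2 + fst a, snd a), RtoC 0)); [|ring].
  apply (at_right_limit_unique (fun t => Hreg ((t, 0), RtoC 0))
    (fun t => t ^ 2 * Fext ((t ^ 2 + fst a, snd a), RtoC 0)) 0).
  - apply filter_imp with (2 := filter_and _ _ (at_right_0_bound 1 Rlt_0_1)
      (at_right_0_configuration sigma n r z k Hsurface Hsheet)).
    intros t [Ht HQ].
    change (Hreg ((t, 0), RtoC 0))
      with (regularized_hamiltonian sigma n r z Omega k 0 (RtoC t) (RtoC 0)).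
    assert (Ht0 : RtoC t <> 0%C) by (intros E; apply RtoC_inj in E; lra).
    rewrite <- transformed_hamiltonian_eq by assumption.
    replace (t ^ 2 + fst a, snd a) with (collision_map n r z k (RtoC t)).
    2: { rewrite collision_map_RtoC; fold a; unfold Cplus; f_equal; apply Rplus_0_l. }
    rewrite Heq by exact HQ; unfold transformed_hamiltonian.
    rewrite Cmod_conj, Cmod_R, pow2_abs, Cconj_conj.
    replace (0 / RtoC t)%C with (RtoC 0) by (field; exact Ht0).
    f_equal; lra.
  - apply (continuous_at_rest Hreg (fun t => t) (fun _ => 0)); [apply continuous_id|apply continuous_const|exact HC].
  - apply (continuous_mult (K := R_AbsRing) (fun t => t ^ 2)).
    + apply continuity_pt_filterlim; reg.
    + apply (continuous_at_rest Fext (fun t => t ^ 2 + fst a) (fun _ => snd a)).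
      * apply continuity_pt_filterlim; reg.
      * apply continuous_const.
      (* At [t = 0] the position is [w_k] itself, the point added to the domain of the supposed
         extension. *)
      * apply (HF O); right; simpl.
        rewrite (surjective_pairing a); simpl; f_equal; ring.
Qed.

(** * Verification of the conditions of [regularizes] *)

Theorem theorem4 (sigma : R) (n : nat) (r z Omega : R)
    (Hsigma : sigma = 1 \/ sigma = -1)
    (Hn : (2 <= n)%nat)
    (Hz : z <> 0)
    (Hr : 0 < r)
    (Hsurface : r ^ 2 + sigma * z ^ 2 = sigma)
    (Hsheet : sigma = -1 -> 0 < z)
    (HOmega : Omega ^ 2 = Omega_sqr sigma n r)
    (k : nat) (Hk : (1 <= k <= n)%nat) :
  regularizes (configuration_space sigma n r z)
              (hamiltonian sigma n r z Omega)
              (primary n r z k)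
              (fun w : C => (w * Cconj w + primary n r z k)%C)
              (fun w : C => Cconj w)
              (fun w : C => (Cmod w) ^ 2).
Proof.
  change (fun w : C => (w * Cconj w + primary n r z k)%C) with (collision_map n r z k).
  destruct (pole_bounds sigma r z Hsigma Hr Hsurface Hsheet) as [Hp Hm].
  assert (Hp' : 1 + z <> 0) by lra.
  assert (Hdist : forall j, (1 <= j <= n)%nat ->
     (j <> k -> primary n r z k <> primary n r z j) /\
     primary n r z k <> antiprimary n r z j).
  { intros j Hj; split.
    - intros Hjk E; apply Hjk; symmetry; now apply (primary_inj n r z k j).
    - now apply primary_neq_antiprimary. }
  split; [|split; [|split; [|split]]].
  - now apply hamiltonian_singular.
  - intros w; now rewrite Cmod_conj.
  - exists 0%C; now apply collision_map_eq_primary.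
  - intros w0 Hw0 eps Heps; apply collision_map_eq_primary in Hw0 as ->.
    destruct (filter_ex _ (filter_and _ _ (at_right_0_bound eps Heps)
      (at_right_0_configuration sigma n r z k Hsurface Hsheet))) as [t [Ht HQ]].
    exists (RtoC t); split; [|split; [exact HQ|]].
    + replace (RtoC t - 0)%C with (RtoC t) by ring.
      rewrite Cmod_R, Rabs_pos_eq; lra.
    + intros E; apply (f_equal Cmod) in E.
      rewrite Cmod_conj, Cmod_R, Cmod_0, Rabs_pos_eq in E; lra.
  - intros Cst.
    exists (fun x => regularized_hamiltonian sigma n r z Omega k Cst (fst x) (snd x)).
    split.
    + apply smooth_regularized_hamiltonian; [exact Hr|].
      (* Away from the collision the configuration space excludes the singular positions; at the
         collision the position is [w_k], and [Hdist] separates it from the others. *)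
      intros x j [[_ HQ]|E] Hj.
      * split; [intros _|]; now apply HQ.
      * change (collision_map n r z k (fst x) = primary n r z k) in E.
        rewrite E; now apply Hdist.
    + intros w W [HQ Hw]; symmetry; simpl fst; simpl snd.
      apply transformed_hamiltonian_eq; [exact Hr| |exact HQ].
      (* Where hat H is defined, [dg w = Cconj w] is nonzero, hence so is [w]. *)
      intros ->; apply Hw; apply Cmod_eq_0; now rewrite Cmod_conj, Cmod_0.
Qed.
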